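(* Let $\mu$ be a probability measure on $\mathbb{R}$ whose support is not included in $(-\infty,0)$, and let $\phi(\lambda)=\int_{\mathbb{R}}e^{\lambda x}\,\mu(dx)\in(0,\infty]$, $\lambda\in\mathbb{R}$. Consider the conditions (a) there exists $\lambda<0$ such that $\phi(\lambda)<1$; (b) there exists $\lambda>0$ such that $\phi(\lambda)\in(1,\infty)$. The knowledge of the restrictions of the measures $\mu^{*n}$, $n\ge1$, to $[0,\infty)$ allows one to determine whether $\mu$ satisfies (a) and whether $\mu$ satisfies (b). When at least one of (a), (b) holds, $\mu\in\mathscr{C}$, i.e. every probability measure $\mu_1$ on $\mathbb{R}$ with $\mu_1^{*n}=\mu^{*n}$ on the Borel subsets of $[0,\infty)$ for all $n\ge1$ satisfies $\mu_1=\mu$.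
   Context: $\mu^{*n}$ is the $n$-fold convolution power of $\mu$. ''Determine'' means: if $\mu_1$ is a probability measure with $\mu_1^{*n}=\mu^{*n}$ on $[0,\infty)$ for all $n\ge1$, then $\mu_1$ satisfies (a) iff $\mu$ does, and $\mu_1$ satisfies (b) iff $\mu$ does. $\mathscr{C}$ is the set of probability measures on $\mathbb{R}$ determined in this sense by their convolution powers restricted to $[0,\infty)$. *)

(* Defs.v *)
From HB Require Import structures.
From mathcomp Require Import all_boot all_order all_algebra.
From mathcomp Require Import all_classical all_reals all_analysis.
Set Implicit Arguments. Unset Strict Implicit. Unset Printing Implicit Defensive.
Import Order.TTheory GRing.Theory Num.Theory.
Import numFieldNormedType.Exports.
Local Open Scope classical_set_scope.
Local Open Scope ring_scope.
Local Open Scope ereal_scope.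

Fixpoint convpow (R : realType) (mu : probability R R) (n : nat) : set R -> \bar R :=
  match n with
  | O => fun A => (0%R \in A)%:R%:E
  | S m => fun A => \int[mu]_x (convpow mu m [set y | (x + y)%R \in A])
  end.

Definition msupport (R : realType) (mu : probability R R) : set R :=
  [set x | forall e : R, (0 < e)%R -> 0 < mu (ball x e)].

Definition laplace (R : realType) (mu : probability R R) (l : R) : \bar R :=
  \int[mu]_x (expR (l * x))%:E.

Definition cond_a (R : realType) (mu : probability R R) : Prop :=
  exists l : R, (l < 0)%R /\ laplace mu l < 1.

Definition cond_b (R : realType) (mu : probability R R) : Prop :=
  exists l : R, (0 < l)%R /\ 1 < laplace mu l /\ laplace mu l < +oo.

Definition same_pos_convpows (R : realType) (mu1 mu : probability R R) : Prop :=
  forall n : nat, (0 < n)%N -> forall A : set R, measurable A ->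
    A `<=` `[0%R, +oo[ -> convpow mu1 n A = convpow mu n A.

(* Main.v *)
(** Write [S_n] for the random walk with step law [mu], [phi] for its Laplace
    transform, and split [phi(l)^n = E(e^{l S_n})] into the part on [S_n >= 0],
    which is common to [mu] and [mu1], and the part [r_n(l)] on [S_n < 0].
    Whenever both remainders satisfy [r_n(l) <= C q^n] with [q < phi(l)], the
    n-th powers of the two Laplace transforms at [l] are so close that the
    transforms agree at [l].
    - Under (b), [r_n(l) <= 1 < phi(l)], and this persists slightly to the left
      of [l] because [phi] is lower semicontinuous.
    - Under (a), [P(S_n < 0) <= phi(l)^n] is exponentially small, for [mu1] as
      well as for [mu]. This forces an exponential left tail of the step law,
      and interpolation gives [r_n(s) <= 2 d^n] with [d < phi(s)] for all
      [s <= 0] close to 0.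
    So the transforms agree on an interval; since [mu] and [mu1] coincide on
    [x >= 0], so do the integrals of [e^{s x}] over [x < 0]. The limit
    [(2 e^{t x / n} - 1)^n --> e^{2 t x}], bounded by 1 for [x <= 0], doubles
    the length of this interval, hence it extends to a ray, and even to all
    [s >= 0] since [1 - (1 - e^{N x})^n] tends to 1. The polynomials
    [(1 - y^n)^(n 2^n)] in [y = e^{c x}], which tend to the indicator of
    [y < 1/2], then recover the measure of every ray [x < a]. *)

Require Import Defs.
From HB Require Import structures.
From mathcomp Require Import all_boot all_order all_algebra.
From mathcomp Require Import all_classical all_reals all_analysis.
From mathcomp Require Import measurable_realfun ring lra.
Set Implicit Arguments.
Unset Strict Implicit.
Unset Printing Implicit Defensive.
Import Order.TTheory GRing.Theory Num.Theory.
Import numFieldNormedType.Exports.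
Local Open Scope classical_set_scope.
Local Open Scope ring_scope.

Local Notation neg := `]-oo, 0%R[%classic.
Local Notation pos := `[0%R, +oo[%classic.

Lemma cvgr_of_dist_le {R : realFieldType} {T : Type} {F : set_system T}
    {FF : Filter F} (f g : T -> R) (l : R) :
  (\forall t \near F, `|f t - l| <= g t) -> g @ F --> 0 -> f @ F --> l.
Proof.
move=> fg g0; apply/subr_cvg0; apply: norm_cvg0.
apply: (squeeze_cvgr _ (cvg_cst 0) g0).
by apply: filterS fg => t ftg; rewrite normr_ge0.
Qed.

Lemma ler_norm_subrXX (R : numDomainType) (a b : R) n :
  `|a| <= 1 -> `|b| <= 1 -> `|a ^+ n - b ^+ n| <= n%:R * `|a - b|.
Proof.
move=> a1 b1; elim: n => [|n IH]; first by rewrite !expr0 subrr normr0 mul0r.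
have -> : a ^+ n.+1 - b ^+ n.+1 = a * (a ^+ n - b ^+ n) + (a - b) * b ^+ n.
  by rewrite !exprS; ring.
rewrite (le_trans (ler_normD _ _))// !normrM -natr1 mulrDl mul1r lerD//.
  by rewrite (le_trans _ IH)// ler_piMl.
by rewrite ler_piMr// normrX exprn_ile1.
Qed.

Lemma cvg_natrM_expr (R : realType) (q : R) : 0 < q < 1 ->
  n%:R * q ^+ n @[n --> \oo] --> 0.
Proof.
move=> /andP[q0 q1]; set r := Num.sqrt q.
have r0 : 0 < r by rewrite sqrtr_gt0.
have r1 : `|r| < 1 by rewrite gtr0_norm// -sqrtr1 ltr_sqrt.
apply: (cvgr_of_dist_le _ (cvg_geometric (1 - r)^-1 r1)).
apply: nearW => n; rewrite subr0 ger0_norm ?mulr_ge0 ?exprn_ge0 ?(ltW q0)//=.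
rewrite -(sqr_sqrtr (ltW q0)) -/r exprAC expr2 mulrA.
rewrite ler_wpM2r ?exprn_ge0 ?(ltW r0)//.
rewrite -[leRHS]mul1r (le_trans _ (geometric_le_lim n ler01 r0 r1))//.
rewrite /series /= mulr_natl -[in X in _ *+ X](subn0 n) -sumr_const_nat.
apply: ler_sum_nat => i /andP[_ /ltnW i_n].
by rewrite mul1r ler_wiXn2l// ltW// -(gtr0_norm r0).
Qed.

Lemma ler_of_exprn_leD (R : archiRealFieldType) (x y q C : R) :
  0 <= q < x -> 0 <= y -> 0 <= C ->
  (forall n, (0 < n)%N -> x ^+ n <= y ^+ n + C * q ^+ n) -> x <= y.
Proof.
move=> /andP[q0 qx] y0 C0 xyq; rewrite leNgt; apply/negP => yx.
have x0 : 0 < x by exact: le_lt_trans qx.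
pose r := Num.max y q / x.
have r0 : 0 <= r by rewrite divr_ge0 ?(ltW x0)// le_max y0.
have r1 : `|r| < 1 by rewrite ger0_norm// ltr_pdivrMr// mul1r gt_max yx.
near \oo => n.
have n0 : (0 < n)%N by near: n; exact: nbhs_infty_gt.
have : geometric (1 + C) r n < 1.
  by near: n; exact: cvgr_lt (cvg_geometric _ r1) _ ltr01.
apply/negP; rewrite -leNgt /= /r expr_div_n mulrA.
rewrite ler_pdivlMr ?exprn_gt0// mul1r.
rewrite (le_trans (xyq n n0))// mulrDl mul1r lerD ?ler_wpM2l//.
  by rewrite lerXn2r ?nnegrE ?le_max ?lexx ?y0.
by rewrite lerXn2r ?nnegrE ?le_max ?lexx ?q0 ?orbT.
Unshelve. all: by end_near. Qed.

Lemma lee_of_expe_leD (R : archiRealFieldType) (x y : \bar R) (q C : R) :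
  0 <= q -> (q%:E < x)%E -> (0 <= y)%E -> 0 <= C ->
  (forall n, (0 < n)%N -> (x ^+ n <= y ^+ n + (C * q ^+ n)%:E)%E) -> (x <= y)%E.
Proof.
move=> q0; case: y => [y||//] qx y0 C0 xyq; last by rewrite leey.
case: x qx xyq => [x||//] qx xyq; last first.
  by have := xyq 1%N erefl; rewrite -EFin_expe -EFinD leye_eq.
rewrite lee_fin; apply: (ler_of_exprn_leD (q := q) (C := C)) => //.
  by rewrite q0.
by move=> n /xyq; rewrite -!EFin_expe -EFinD lee_fin.
Qed.

Lemma cvg_expR_double (R : realType) (z : R) : z <= 0 ->
  (2 * expR (z / n.+1%:R) - 1) ^+ n.+1 @[n --> \oo] --> expR (2 * z).
Proof.
move=> z0; apply: (cvgr_of_dist_le (g := fun n => z ^+ 2 * harmonic n)).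
  apply: nearW => n; set w := z / _; set u := expR w.
  have w0 : w <= 0 by rewrite /w mulr_le0_ge0// invr_ge0.
  have u1 : u <= 1 by rewrite expR_le1.
  have u0 : 0 < u by exact: expR_gt0.
  have -> : expR (2 * z) = (u ^+ 2) ^+ n.+1.
    by rewrite -exprM -expRM_natl natrM -mulrA /w [n.+1%:R * _]mulrC divfK.
  apply: le_trans (ler_norm_subrXX _ _ _) _.
  - by rewrite ler_norml; lra.
  - by rewrite normrX exprn_ile1// gtr0_norm.
  have -> : 2 * u - 1 - u ^+ 2 = - (1 - u) ^+ 2 by ring.
  have -> : z ^+ 2 * harmonic n = n.+1%:R * w ^+ 2.
    by rewrite /w /harmonic /=; field; rewrite gt_eqF.
  rewrite normrN normrX ler_wpM2l// ger0_norm ?subr_ge0//.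
  rewrite -[w ^+ 2]sqrrN lerXn2r// ?nnegrE ?subr_ge0// ?oppr_ge0//.
  by have := expR_ge1Dx w; rewrite -/u; lra.
rewrite -[X in _ --> X](mulr0 (z ^+ 2)).
by apply: cvgMl_tmp; exact: cvg_harmonic.
Qed.

Lemma cvg_onem_exprn_indic (R : realType) (y : R) : 0 < y < 1 ->
  (1 - y ^+ n) ^+ (n * 2 ^ n) @[n --> \oo] --> ((y < 2^-1)%R%:R : R).
Proof.
move=> /andP[y0 y1].
have onem01 n : 0 <= 1 - y ^+ n <= 1.
  by rewrite subr_ge0 exprn_ile1 ?(ltW y0) ?(ltW y1)//= gerBl exprn_ge0// ltW.
have exponentE n : (n * 2 ^ n)%:R * y ^+ n = n%:R * (2 * y) ^+ n.
  by rewrite natrM natrX exprMn mulrA.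
case: ltP => y2.
  apply: (cvgr_of_dist_le (g := fun n => n%:R * (2 * y) ^+ n)); last first.
    by apply: cvg_natrM_expr; lra.
  apply: nearW => n; rewrite -exponentE.
  rewrite distrC -[X in X - _](expr1n _ (n * 2 ^ n)).
  have /andP[? ?] := onem01 n.
  rewrite (le_trans (ler_norm_subrXX _ _ _)) ?normr1 ?ger0_norm// ?subKr//.
  by rewrite exprn_ge0// ltW.
rewrite mulr0n; apply: cvgr_of_dist_le (@cvgn_expR R).
apply: nearW => n; have /andP[? ?] := onem01 n.
rewrite subr0 ger0_norm ?exprn_ge0//.
apply: (@le_trans _ _ (expR (- y ^+ n) ^+ (n * 2 ^ n))).
  by rewrite lerXn2r ?nnegrE ?expR_ge0// expR_ge1Dx.
rewrite -expRM_natl mulrN exponentE ler_expR lerN2 ler_peMr//.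
by rewrite exprn_ege1//; lra.
Qed.

Lemma exists_exprnM_le1 (R : archiRealFieldType) (a b : R) : `|a| < 1 ->
  exists n, a ^+ n * b <= 1.
Proof.
move=> a1.
have [n _ /(_ n (leqnn n)) /ltW abn] : \forall n \near \oo, geometric b a n < 1.
  exact: cvgr_lt (cvg_geometric b a1) _ ltr01.
by exists n; rewrite mulrC.
Qed.

(* [a] is the geometric mean of the two terms on the right, with weights
   [(k + 1) / (k + 2)] and [1 / (k + 2)]. *)
Lemma le_invD_exprM (R : realFieldType) (x a : R) k : 0 < x -> 0 < a ->
  a <= x^-1 + x ^+ k.+1 * a ^+ k.+2.
Proof.
move=> x0 a0; have [ax|xa] := leP (a * x) 1.
  rewrite ler_wpDr//; first by rewrite mulr_ge0// exprn_ge0// ltW.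
  by rewrite -[leRHS]mul1r ler_pdivlMr.
rewrite ler_wpDl//; first by rewrite invr_ge0 ltW.
rewrite [a ^+ k.+2]exprS mulrCA -exprMn ler_peMr ?(ltW a0)//.
by rewrite mulrC exprn_ege1// ltW.
Qed.

Lemma norm_double_expR_le1 (R : realType) (t x : R) : 0 <= t -> x <= 0 ->
  `|2 * expR (t * x) - 1| <= 1.
Proof.
move=> t0 x0; have := expR_gt0 (t * x).
have : expR (t * x) <= 1 by rewrite expR_le1 mulr_ge0_le0.
by rewrite ler_norml; lra.
Qed.

Section lower_semicontinuous_integral.
Local Open Scope ereal_scope.
Context d (T : measurableType d) (R : realType).
Variables (mu : {measure set T -> \bar R}) (D : set T).
Hypothesis mD : measurable D.

Lemma lower_semicontinuous_integral (f : R -> T -> \bar R) :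
  (forall s, measurable_fun D (f s)) -> (forall s x, D x -> 0 <= f s x) ->
  (forall x, D x -> continuous (f ^~ x)) ->
  lower_semicontinuous (fun s => \int[mu]_(x in D) f s x).
Proof.
move=> mf f0 cf s a; apply: contraPP => notV; apply/negP; rewrite -leNgt.
have /choice[u u_] n : exists t,
    ball s n.+1%:R^-1 t /\ \int[mu]_(x in D) f t x <= a%:E.
  apply: contrapT => /forallNP noT; apply: notV.
  exists (ball s n.+1%:R^-1); first exact: nbhsx_ballx.
  move=> t st; rewrite ltNge; apply/negP => fta; exact: (noT t).
have us : u n @[n --> \oo] --> s.
  apply: (cvgr_of_dist_le _ cvg_harmonic); apply: nearW => n.
  by have [/ltW] := u_ n; rewrite distrC.
under eq_integral => x /set_mem Dx.
  have /(cvg_comp _ _ us)/cvg_limn_einf_sup[<- _] := cf x Dx s.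
  over.
apply: (le_trans (fatou _ mD _ _)) => //; first by move=> n x; exact: f0.
rewrite limn_einf_lim; apply: lime_le; first exact: is_cvg_einfs.
apply: nearW => n; apply: le_trans (u_ n).2.
by apply: ereal_inf_lbound; exists n => /=.
Qed.

End lower_semicontinuous_integral.

Section same_integral.
Local Open Scope ereal_scope.
Context d (T : measurableType d) (R : realType).
Variables (m1 m2 : {measure set T -> \bar R}) (D : set T).
Hypothesis mD : measurable D.
Implicit Types f g : T -> R.

Definition same_integral f :=
  [/\ m1.-integrable D (EFin \o f), m2.-integrable D (EFin \o f) &
      \int[m1]_(x in D) (f x)%:E = \int[m2]_(x in D) (f x)%:E].

Lemma same_integral0 : same_integral (fun=> 0%R).
Proof.
by split; [exact: integrable0|exact: integrable0|rewrite !integral0].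
Qed.

Lemma same_integralD f g :
  same_integral f -> same_integral g -> same_integral (fun x => f x + g x)%R.
Proof.
move=> [f1 f2 fE] [g1 g2 gE]; split.
- exact: (integrableD _ f1 g1).
- exact: (integrableD _ f2 g2).
- by rewrite !integralD_EFin// fE gE.
Qed.

Lemma same_integralZ (c : R) f :
  same_integral f -> same_integral (fun x => c * f x)%R.
Proof.
move=> [f1 f2 fE]; split.
- exact: (integrableZl _ c f1).
- exact: (integrableZl _ c f2).
- under eq_integral do rewrite EFinM.
  under [RHS]eq_integral do rewrite EFinM.
  by rewrite !integralZl//= fE.
Qed.

Lemma same_integral_sum n (f_ : nat -> T -> R) (c : nat -> R) :
  (forall i, (i < n)%N -> same_integral (f_ i)) ->
  same_integral (fun x => \sum_(i < n) c i * f_ i x)%R.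
Proof.
elim: n => [|n IH] sf.
  by under eq_fun do rewrite big_ord0; exact: same_integral0.
under eq_fun do rewrite big_ord_recr/=.
apply: same_integralD; last exact/same_integralZ/sf.
by apply: IH => i /ltnW; exact: sf.
Qed.

Lemma same_integral_cvg (f_ : (T -> R)^nat) f g :
  (forall n, same_integral (f_ n)) ->
  m1.-integrable D (EFin \o g) -> m2.-integrable D (EFin \o g) ->
  (forall n x, D x -> `|f_ n x| <= g x)%R ->
  (forall x, D x -> f_ ^~ x @ \oo --> f x) -> same_integral f.
Proof.
move=> sf g1 g2 fg cvf.
have mf_ n : measurable_fun D (EFin \o f_ n) by have [/measurable_int] := sf n.
have mf : measurable_fun D (EFin \o f).
  apply/measurable_EFinP; apply: measurable_fun_cvg cvf => n.
  exact/measurable_EFinP.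
have dominated (m : {measure set T -> \bar R}) : m.-integrable D (EFin \o g) ->
    m.-integrable D (EFin \o f) /\
    \int[m]_(x in D) (f_ n x)%:E @[n --> \oo] --> \int[m]_(x in D) (f x)%:E.
  move=> ig; have [] := dominated_convergence mD mf_ mf _ ig _ => //.
  - by apply: aeW => x Dx; apply: cvg_comp (cvf x Dx) _; exact: cvg_id.
  - by apply: aeW => x n Dx; rewrite lee_fin fg.
have [f1 cv1] := dominated _ g1; have [f2 cv2] := dominated _ g2; split=> //.
rewrite -(cvg_lim _ cv1)// -(cvg_lim _ cv2)//; apply: congr_lim.
by apply/funext => n; have [] := sf n.
Qed.

End same_integral.

Section laplace_on.
Local Open Scope ereal_scope.
Variable R : realType.
Implicit Types (m : {measure set R -> \bar R}) (D : set R) (l : R).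

Lemma measurable_EFin_expRM l D :
  measurable_fun D (fun x : R => (expR (l * x))%:E).
Proof. by apply/measurable_EFinP; apply: (measurableT_comp (f := @expR R)). Qed.

Definition laplace_on m D l : \bar R := \int[m]_(x in D) (expR (l * x))%:E.

Lemma laplace_on_ge0 m D l : 0 <= laplace_on m D l.
Proof. exact: integral_ge0. Qed.

Lemma laplace_on0 m D : measurable D -> laplace_on m D 0 = m D.
Proof.
move=> mD; rewrite /laplace_on; under eq_integral do rewrite mul0r expR0.
by rewrite integral_cst// mul1e.
Qed.

Lemma le_laplace_on m D l1 l2 : measurable D ->
  (forall x, D x -> l1 * x <= l2 * x)%R ->
  laplace_on m D l1 <= laplace_on m D l2.
Proof.
move=> mD le12; apply: ge0_le_integral => //.
- exact: measurable_EFin_expRM.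
- exact: measurable_EFin_expRM.
- by move=> x Dx; rewrite lee_fin ler_expR le12.
Qed.

Lemma le_laplace_on_setT m D l : measurable D ->
  laplace_on m D l <= laplace_on m setT l.
Proof.
by move=> mD; apply: ge0_subset_integral => //; exact: measurable_EFin_expRM.
Qed.

Lemma laplace_onC m D l : measurable D ->
  laplace_on m setT l = laplace_on m D l + laplace_on m (~` D) l.
Proof.
move=> mD; rewrite /laplace_on -(setUv D) ge0_integral_setU//.
- exact: measurableC.
- by rewrite setUv; exact: measurable_EFin_expRM.
- by apply/disj_setPCl.
Qed.

End laplace_on.

Section convolution.
Local Open Scope ereal_scope.
Variable R : realType.
Implicit Types m : probability R R.

Definition add_pair (p : R * R) : R := (p.1 + p.2)%R.

Lemma measurable_add_pair : measurable_fun setT add_pair.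
Proof. exact: measurable_funD. Qed.

HB.instance Definition _ :=
  isMeasurableFun.Build _ _ _ _ add_pair measurable_add_pair.

Definition convolution m1 m2 : probability R R :=
  distribution (m1 \x m2) add_pair.

Lemma convolutionE m1 m2 A :
  convolution m1 m2 A = \int[m1]_x m2 [set y | (x + y)%R \in A].
Proof.
rewrite /convolution /distribution /pushforward /product_measure1 /=.
by apply: eq_integral => x _; congr (m2 _).
Qed.

Lemma ge0_integral_convolution m1 m2 (f : R -> \bar R) :
  measurable_fun setT f -> (forall x, 0 <= f x) ->
  \int[convolution m1 m2]_x f x = \int[m1]_x \int[m2]_y f (x + y)%R.
Proof.
move=> mf f0; rewrite ge0_integral_distribution// fubini_tonelli1//.
  by apply: measurableT_comp => //; exact: measurable_add_pair.
by move=> p; exact: f0.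
Qed.

Lemma laplace_convolution m1 m2 l :
  laplace (convolution m1 m2) l = laplace m1 l * laplace m2 l.
Proof.
rewrite /laplace ge0_integral_convolution//; last exact: measurable_EFin_expRM.
under eq_integral => x _.
  under eq_integral do rewrite mulrDr expRD EFinM.
  rewrite ge0_integralZl//; last exact: measurable_EFin_expRM.
  over.
rewrite ge0_integralZr//; first exact: measurable_EFin_expRM.
exact: integral_ge0.
Qed.

Lemma mule_le_convolution m1 m2 (A B C : set R) :
  measurable A -> measurable B -> measurable C ->
  (forall x y, A x -> B y -> C (x + y)%R) ->
  m1 A * m2 B <= convolution m1 m2 C.
Proof.
move=> mA mB mC ABC; rewrite -product_measure1E// le_measure ?inE//.
- exact: measurableX.
- by rewrite -[X in measurable X]setTI; exact: measurable_add_pair.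
- by move=> [x y] /= [Ax By]; exact: ABC.
Qed.

Fixpoint iter_convolution m n : probability R R :=
  if n is k.+1 then convolution m (iter_convolution m k) else dirac (0%R : R).

Lemma convpowE m n A : convpow m n A = iter_convolution m n A.
Proof.
elim: n A => [|n IH] A; first by rewrite /= /dirac indicE.
by rewrite [RHS]convolutionE; apply: eq_integral => x _; exact: IH.
Qed.

Lemma iter_convolution1 m A : measurable A -> iter_convolution m 1 A = m A.
Proof.
move=> mA; rewrite convolutionE -[in RHS](setIT A) -integral_indic//.
apply: eq_integral => x _; rewrite /= diracE indicE.
by congr ((nat_of_bool _)%:R%:E); apply/idP/idP; rewrite !inE /= addr0 inE.
Qed.

Lemma laplace_iter_convolution m n l :
  laplace (iter_convolution m n) l = laplace m l ^+ n.
Proof.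
elim: n => [|n IH]; last by rewrite expeS -IH; exact: laplace_convolution.
rewrite /laplace integral_dirac//= ?diracT ?mul1e ?mulr0 ?expR0//.
exact: measurable_EFin_expRM.
Qed.

Lemma iter_convolution_ray_ge m (d M : R) n : (0 <= d)%R ->
  d%:E <= m `]-oo, M]%classic ->
  (d ^+ n)%:E <= iter_convolution m n `]-oo, (n%:R * M)%R]%classic.
Proof.
move=> d0 dM; elim: n => [|n IH].
  by rewrite mul0r /= /dirac indicE mem_set//= in_itv/=.
apply: (@le_trans _ _ (m `]-oo, M]%classic *
    iter_convolution m n `]-oo, (n%:R * M)%R]%classic)).
  by rewrite exprS EFinM lee_pmul// lee_fin// exprn_ge0.
apply: mule_le_convolution => // x y /=.
by rewrite !in_itv/= -natr1 mulrDl mul1r; lra.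
Qed.

End convolution.

Section same_integral_expR.
Variable R : realType.
Variables (m1 m2 : {finite_measure set R -> \bar R}) (D : set R).
Hypotheses (mD : measurable D) (D_lt0 : forall x, D x -> x < 0).
Local Notation same_integral := (same_integral m1 m2 D).
Local Notation same_expR s := (same_integral (fun x => expR (s * x))).

Lemma same_integral_expR_horner (l h : R) (p : {poly R}) :
  (forall i, (i < size p)%N -> same_expR (l + i%:R * h)) ->
  same_integral (fun x => expR (l * x) * p.[expR (h * x)]).
Proof.
move=> /(same_integral_sum mD (fun i => p`_i)); congr same_integral.
apply/funext => x; rewrite horner_coef mulr_sumr; apply: eq_bigr => i _.
by rewrite mulrDl expRD mulrCA -mulrA expRM_natl.
Qed.

(* Only exponents in [0, t] occur in the expansion of [(2 e^{tx/n} - 1)^n],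
   which tends to [e^{2tx}]. *)
Lemma same_integral_expR_double (l h : R) : 0 <= h ->
  (forall s, l <= s <= l + h -> same_expR s) ->
  forall s, l <= s <= l + 2 * h -> same_expR s.
Proof.
move=> h0 same_lh s /andP[ls slh]; pose t := (s - l) / 2.
have /andP[t0 th] : 0 <= t <= h by rewrite /t; lra.
have tn0 n : 0 <= t / n.+1%:R by exact: divr_ge0.
have same_l : same_expR l by apply: same_lh; rewrite lexx lerDl.
pose p n : {poly R} := 2 ^+ n *: ('X - (2^-1)%:P) ^+ n.
have pE n y : (p n).[y] = (2 * y - 1) ^+ n.
  by rewrite /p !hornerE -exprMn mulrBr divff.
apply: (same_integral_cvg mD (g := fun x => expR (l * x))
  (f_ := fun n x => expR (l * x) * (p n.+1).[expR (t / n.+1%:R * x)])).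
- move=> n; apply: same_integral_expR_horner => i.
  rewrite size_scale ?expf_neq0// size_exp_XsubC ltnS => i_n; apply: same_lh.
  apply/andP; split; first by rewrite lerDl mulr_ge0.
  rewrite lerD2l (le_trans _ th)//.
  by rewrite mulrCA ler_piMr// ler_pdivrMr// mul1r ler_nat.
- by have [] := same_l.
- by have [] := same_l.
- move=> n x /D_lt0/ltW x0; rewrite normrM ger0_norm ?expR_ge0//.
  by rewrite ler_piMr ?expR_ge0// pE normrX exprn_ile1// norm_double_expR_le1.
- move=> x /D_lt0/ltW x0.
  have -> : expR (s * x) = expR (l * x) * expR (2 * (t * x)).
    by rewrite -expRD /t; congr expR; field.
  apply: cvgMl_tmp; under eq_cvg do rewrite pE mulrAC.
  by apply: cvg_expR_double; rewrite mulr_ge0_le0.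
Qed.

Lemma same_integral_expR_ray (l h : R) : 0 < h ->
  (forall s, l <= s <= l + h -> same_expR s) -> forall s, l <= s -> same_expR s.
Proof.
move=> h0 same_lh s ls.
have same_expn n : forall t, l <= t <= l + 2 ^+ n * h -> same_expR t.
  elim: n => [|n IH]; first by rewrite mul1r.
  rewrite exprS -mulrA; apply: same_integral_expR_double => //.
  by rewrite mulr_ge0// ?exprn_ge0// ltW.
apply: (same_expn (Num.bound ((s - l) / h))); rewrite ls/= -lerBlDl.
by rewrite -ler_pdivrMr// ltW// upper_nthrootP.
Qed.

(* [e^{sx} (1 - (1 - e^{Nx})^n)] tends to [e^{sx}], and all the exponents of its
   expansion are at least [s + N]. *)
Lemma same_integral_expR_ge0 (l : R) : (forall s, l <= s -> same_expR s) ->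
  forall s, 0 <= s -> same_expR s.
Proof.
move=> same_l s s0; pose N := `|l| + 1.
have N0 : 0 < N by rewrite ltr_wpDl.
have lN : l <= N by rewrite (le_trans (ler_norm _))// lerDl.
pose p n : {poly R} := \sum_(i < n) (1 - 'X) ^+ i.
have pE n x : expR ((s + N) * x) * (p n).[expR (N * x)] =
    expR (s * x) * (1 - (1 - expR (N * x)) ^+ n).
  rewrite mulrDl expRD -mulrA; congr (_ * _); set y := expR _.
  rewrite -[RHS]opprB subrX1 -mulNr opprB subKr /p horner_sum; congr (_ * _).
  by apply: eq_bigr => i _; rewrite horner_exp !hornerE.
have onem_expR01 x : D x -> 0 <= 1 - expR (N * x) < 1.
  move=> /D_lt0 x0; rewrite subr_ge0 expR_le1 gtrBl expR_gt0.
  by rewrite pmulr_rle0// ltW.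
apply: (same_integral_cvg mD (g := fun=> 1)
  (f_ := fun n x => expR ((s + N) * x) * (p n).[expR (N * x)])).
- move=> n; apply: same_integral_expR_horner => i _; apply: same_l.
  by rewrite (le_trans lN)// -addrA ler_wpDl// lerDl mulr_ge0// ltW.
- exact: finite_measure_integrable_cst.
- exact: finite_measure_integrable_cst.
- move=> n x Dx; have /andP[y0 /ltW y1] := onem_expR01 x Dx.
  rewrite pE normrM mulr_ile1// ger0_norm ?expR_ge0//.
  + by rewrite expR_le1 mulr_ge0_le0// ltW// D_lt0.
  + by rewrite gerBl exprn_ge0.
  + by rewrite subr_ge0 exprn_ile1.
- move=> x Dx; have /andP[y0 y1] := onem_expR01 x Dx.
  have : expR (s * x) * (1 - (1 - expR (N * x)) ^+ n) @[n --> \oo] -->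
      expR (s * x) * (1 - 0).
    apply: cvgMl_tmp; apply: cvgB; first exact: cvg_cst.
    by apply: cvg_expr; rewrite ger0_norm.
  by rewrite subr0 mulr1; under [X in _ -> X]eq_cvg do rewrite pE.
Qed.

Lemma same_integral_indic_ray (a : R) : a < 0 ->
  (forall s, 0 <= s -> same_expR s) -> same_integral (fun x => (x < a)%R%:R).
Proof.
move=> a0 same_ge0; pose c := ln 2 / - a.
have ln2 : 0 < ln 2 :> R by rewrite ln_gt0// ltr1n.
have c0 : 0 < c by rewrite divr_gt0// oppr_gt0.
pose p n : {poly R} := (1 - 'X) ^+ (n * 2 ^ n).
have pE n x : expR (0 * x) * (p n).[expR (n%:R * c * x)] =
    (1 - expR (c * x) ^+ n) ^+ (n * 2 ^ n).
  by rewrite mul0r expR0 mul1r -mulrA expRM_natl /p horner_exp !hornerE.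
apply: (same_integral_cvg mD (g := fun=> 1)
  (f_ := fun n x => expR (0 * x) * (p n).[expR (n%:R * c * x)])).
- move=> n; apply: same_integral_expR_horner => i _; apply: same_ge0.
  by rewrite add0r mulr_ge0// mulr_ge0// ltW.
- exact: finite_measure_integrable_cst.
- exact: finite_measure_integrable_cst.
- move=> n x /D_lt0/ltW x0; rewrite pE normrX exprn_ile1//.
  have : expR (c * x) ^+ n <= 1.
    by rewrite exprn_ile1 ?expR_ge0// expR_le1 pmulr_rle0.
  by have := exprn_ge0 n (expR_ge0 (c * x)); rewrite ler_norml; lra.
- move=> x /D_lt0 x0; under eq_cvg do rewrite pE.
  have -> : (x < a) = (expR (c * x) < 2^-1).
    rewrite -[2^-1]lnK ?posrE ?invr_gt0// ltr_expR lnV ?posrE//.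
    rewrite /c mulrAC ltr_pdivrMr ?oppr_gt0// mulrNN mulrC.
    by rewrite [ln 2 * a]mulrC ltr_pM2r.
  apply: cvg_onem_exprn_indic; rewrite expR_gt0/= expR_lt1.
  by rewrite pmulr_rlt0.
Qed.

End same_integral_expR.

Section half_line_uniqueness.
Local Open Scope ereal_scope.
Variable R : realType.

Lemma integrable_expR (m : {measure set R -> \bar R}) (D : set R) (s : R) :
  measurable D -> laplace_on m D s < +oo ->
  m.-integrable D (fun x => (expR (s * x))%:E).
Proof.
move=> mD fin; apply/integrableP; split; first exact: measurable_EFin_expRM.
by under eq_integral do rewrite /= ger0_norm ?expR_ge0//.
Qed.

Lemma eq_ray_of_eq_laplace_neg (m1 m2 : {finite_measure set R -> \bar R})
    (l h a : R) : (0 < h)%R -> (a < 0)%R ->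
  (forall s, (l <= s <= l + h)%R ->
    laplace_on m1 neg s = laplace_on m2 neg s /\ laplace_on m1 neg s < +oo) ->
  m1 `]-oo, a[%classic = m2 `]-oo, a[%classic.
Proof.
move=> h0 a0 eqL.
have neg_lt0 (x : R) : neg x -> (x < 0)%R by rewrite /= in_itv.
have same_lh s : (l <= s <= l + h)%R ->
    same_integral m1 m2 neg (fun x => expR (s * x)).
  by move=> /eqL[E fin]; split=> //; apply: integrable_expR => //; rewrite -E.
have same_ray := same_integral_expR_ray (measurable_itv _) neg_lt0 h0 same_lh.
have same_ge0 := same_integral_expR_ge0 (measurable_itv _) neg_lt0 same_ray.
have [_ _] := same_integral_indic_ray (measurable_itv _) neg_lt0 a0 same_ge0.
have integral_ray (m : {measure set R -> \bar R}) :
    \int[m]_(x in neg) ((x < a)%R%:R)%:E = m `]-oo, a[%classic.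
  transitivity (\int[m]_(x in neg) (\1_`]-oo, a[ x)%:E).
    by apply: eq_integral => x _; rewrite indicE/= mem_setE in_itv.
  rewrite integral_indic// setIidl// => x /=.
  by rewrite !in_itv/= => /lt_trans; exact.
by rewrite !integral_ray.
Qed.

Lemma eq_measure_of_eq_ray (m1 m2 : {finite_measure set R -> \bar R}) :
  (forall a, m1 `]-oo, a[%classic = m2 `]-oo, a[%classic) ->
  forall A, measurable A -> m1 A = m2 A.
Proof.
move=> eq_ray; apply: (@measure_unique _ _ _ (@RGenInftyO.G R)
  (fun n => `]-oo, n%:R[%classic)).
- exact: RGenInftyO.measurableE.
- move=> _ _ [a ->] [b ->]; exists (Num.min a b).
  by apply/seteqP; split => x /=; rewrite !in_itv/= lt_min => /andP.
- by move=> n; exists n%:R.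
- apply/seteqP; split => // x _; exists (Num.truncn x).+1 => //=.
  by rewrite in_itv/= truncnS_gt.
- by move=> _ [a ->]; exact: eq_ray.
- by move=> n; rewrite -ge0_fin_numE// fin_num_measure.
Qed.

End half_line_uniqueness.

Section exponential_tail.
Local Open Scope ereal_scope.
Variable R : realType.
Implicit Types (m : {measure set R -> \bar R}) (D : set R) (d l w M x : R).

Lemma cvg_measure_ray m : m `]-oo, n%:R]%classic @[n --> \oo] --> m setT.
Proof.
have <- : \bigcup_n `]-oo, (n%:R : R)]%classic = setT.
  apply/seteqP; split => // x _; exists (Num.truncn x).+1 => //=.
  by rewrite in_itv/= ltW// truncnS_gt.
apply: nondecreasing_cvg_mu => //; first exact: bigcup_measurable.
move=> i j ij; apply/subsetPset => x /=; rewrite !in_itv/= => /le_trans; apply.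
by rewrite ler_nat.
Qed.

Definition tail_term w M n x : \bar R :=
  (w ^+ n.+1)%:E * (\1_(`]-oo, (- (n%:R * M))%R]%classic) x)%:E.

Lemma tail_term_ge0 w M n x : (0 <= w)%R -> 0 <= tail_term w M n x.
Proof. by move=> w0; rewrite mule_ge0// lee_fin exprn_ge0. Qed.

Lemma measurable_tail_term w M n D : measurable_fun D (tail_term w M n).
Proof. by apply/measurable_EFinP; exact: measurable_funM. Qed.

Definition geometric_tail w M x : \bar R := \sum_(0 <= n <oo) tail_term w M n x.

Lemma measurable_geometric_tail w M D :
  (0 <= w)%R -> measurable_fun D (geometric_tail w M).
Proof.
move=> w0; apply: ge0_emeasurable_sum => [n x _ _|n _].
  exact: tail_term_ge0.
exact: measurable_tail_term.
Qed.

Lemma expR_le_geometric_tail l M x : (l <= 0)%R -> (0 < M)%R -> (x <= 0)%R ->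
  (expR (l * x))%:E <= geometric_tail (expR (- (l * M))) M x.
Proof.
move=> l0 M0 x0; pose n := Num.truncn (- x / M).
have /andP[nx xn] : (n%:R <= - x / M < n.+1%:R)%R.
  by apply: truncn_itv; rewrite divr_ge0 ?oppr_ge0// ltW.
apply: le_trans (nneseries_lim_ge n.+1 _) => [|k _ _]; last first.
  exact: tail_term_ge0 (expR_ge0 _).
rewrite big_nat_recr//= (le_trans _ (leeDr _ _))//; last first.
  by apply: sume_ge0 => k _; exact: tail_term_ge0 (expR_ge0 _).
rewrite /tail_term indicE mem_set ?mule1; last first.
  by rewrite /= in_itv/= lerNr -ler_pdivlMr.
rewrite lee_fin -expRM_natl ler_expR mulrN mulrCA -mulrN ler_wnM2l//.
by rewrite lerNl -ler_pdivrMr// ltW.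
Qed.

Lemma integral_geometric_tail_le m D w M d :
  measurable D -> (0 < w)%R -> (0 < d)%R -> (w * d < 1)%R ->
  (forall n, m `]-oo, (- (n%:R * M))%R]%classic <= (d ^+ n)%:E) ->
  \int[m]_(x in D) geometric_tail w M x <= (w / (1 - w * d))%:E.
Proof.
move=> mD w0 d0 wd1 tail; have wd0 : (0 < w * d)%R by exact: mulr_gt0.
have term_ge0 n x : 0 <= tail_term w M n x by exact: tail_term_ge0 (ltW w0).
rewrite integral_nneseries//; last by move=> n; exact: measurable_tail_term.
apply: lime_le; first by apply: is_cvg_nneseries => n _ _; exact: integral_ge0.
apply: nearW => N.
apply: (@le_trans _ _ (series (geometric w (w * d)) N)%:E); last first.
  by rewrite lee_fin geometric_le_lim ?gtr0_norm// ltW.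
rewrite /series /= -sumEFin; apply: lee_sum => n _.
rewrite ge0_integralZl//; last by rewrite lee_fin exprn_ge0// ltW.
  rewrite integral_indic// exprMn mulrA -exprS EFinM lee_wpmul2l//.
    by rewrite lee_fin exprn_ge0// ltW.
  by rewrite (le_trans _ (tail n))// le_measure ?inE//; exact: measurableI.
by apply/measurable_EFinP; exact: measurable_indic.
Qed.

Lemma laplace_neg_lty_of_tail m d M : (0 < d < 1)%R -> (0 < M)%R ->
  (forall n, m `]-oo, (- (n%:R * M))%R]%classic <= (d ^+ n)%:E) ->
  exists2 l, (l < 0)%R & laplace_on m neg l < +oo.
Proof.
move=> /andP[d0 d1] M0 tail; pose l := (ln ((1 + d) / 2) / M)%R.
have l0 : (l < 0)%R by rewrite /l pmulr_llt0 ?invr_gt0// ln_lt0//; lra.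
pose w := expR (- (l * M)).
have w0 : (0 < w)%R by exact: expR_gt0.
have wE : (w * ((1 + d) / 2) = 1)%R.
  by rewrite /w divfK ?gt_eqF// expRN lnK ?mulVf ?gt_eqF// ?posrE; lra.
have wd1 : (w * d < 1)%R by rewrite -[ltRHS]wE ltr_pM2l//; lra.
exists l => //.
apply: (@le_lt_trans _ _ (w / (1 - w * d))%:E); last exact: ltry.
apply: le_trans (integral_geometric_tail_le (measurable_itv _) w0 d0 wd1 tail).
apply: ge0_le_integral => //.
- exact: measurable_EFin_expRM.
- exact: measurable_geometric_tail (ltW w0).
- move=> x /=; rewrite in_itv/= => /ltW.
  by apply: expR_le_geometric_tail => //; exact: ltW.
Qed.

Lemma laplace_on_interpolation m D l d k :
  measurable D -> (0 < d)%R ->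
  laplace_on m D (l / k.+2%:R) <=
  (d^-1)%:E * m D + (d ^+ k.+1)%:E * laplace_on m D l.
Proof.
move=> mD d0; have dk0 : (0 <= d ^+ k.+1)%R by rewrite exprn_ge0// ltW.
have di0 : (0 <= d^-1)%R by rewrite invr_ge0 ltW.
rewrite -integral_cst// /laplace_on -ge0_integralZl//; last first.
  exact: measurable_EFin_expRM.
have mexp : measurable_fun D (fun x => (d ^+ k.+1)%:E * (expR (l * x))%:E).
  by apply: emeasurable_funM => //; exact: measurable_EFin_expRM.
rewrite -ge0_integralD//; last by move=> x _; rewrite mule_ge0.
apply: ge0_le_integral => //.
- exact: measurable_EFin_expRM.
- exact: emeasurable_funD.
move=> x Dx; rewrite -EFinM -EFinD lee_fin.
have -> : expR (l * x) = (expR (l / k.+2%:R * x) ^+ k.+2)%R.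
  by rewrite -expRM_natl; congr expR; field.
exact: le_invD_exprM (expR_gt0 _).
Qed.

End exponential_tail.

Section laplace_transform.
Local Open Scope ereal_scope.
Variable R : realType.
Implicit Types (m : probability R R) (l T : R).

Lemma laplace_neg_pos m l :
  laplace m l = laplace_on m neg l + laplace_on m pos l.
Proof. by rewrite -setCitvl; exact: laplace_onC. Qed.

Lemma laplace_on_le1 m (D : set R) l : measurable D ->
  (forall x, D x -> l * x <= 0)%R -> laplace_on m D l <= 1.
Proof.
move=> mD lD; apply: (@le_trans _ _ (laplace_on m D 0)).
  by apply: le_laplace_on => // x /lD; rewrite mul0r.
by rewrite laplace_on0// probability_le1.
Qed.

Lemma laplace_neg_le1 m l : (0 <= l)%R -> laplace_on m neg l <= 1.
Proof.
move=> l0; apply: laplace_on_le1 => // x; rewrite /= in_itv/= => /ltW.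
exact: mulr_ge0_le0.
Qed.

Lemma laplace_pos_le1 m l : (l <= 0)%R -> laplace_on m pos l <= 1.
Proof.
move=> l0; apply: laplace_on_le1 => // x; rewrite /= in_itv/= andbT.
exact: mulr_le0_ge0.
Qed.

Lemma laplace_lty_EFin m l : laplace m l < +oo ->
  exists2 L : R, (0 <= L)%R & laplace m l = L%:E.
Proof.
move=> fin; exists (fine (laplace m l)).
  by rewrite fine_ge0// laplace_on_ge0.
by rewrite fineK// ge0_fin_numE// laplace_on_ge0.
Qed.

Lemma laplace_lty_of_neg m l : (l <= 0)%R -> laplace_on m neg l < +oo ->
  laplace m l < +oo.
Proof.
move=> l0 fin; rewrite laplace_neg_pos lte_add_pinfty//.
by rewrite (le_lt_trans (laplace_pos_le1 _ l0))// ltry.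
Qed.

Lemma laplace_lty_le m l1 l2 : (0 <= l1 <= l2)%R -> laplace m l2 < +oo ->
  laplace m l1 < +oo.
Proof.
move=> /andP[l1_ge0 l12] fin; rewrite laplace_neg_pos; apply: lte_add_pinfty.
  by rewrite (le_lt_trans (laplace_neg_le1 _ l1_ge0))// ltry.
apply: (@le_lt_trans _ _ (laplace_on m pos l2)); last first.
  by rewrite (le_lt_trans _ fin)// le_laplace_on_setT.
apply: le_laplace_on => // x; rewrite /= in_itv/= andbT => x0.
by rewrite ler_wpM2r.
Qed.

Lemma lower_semicontinuous_laplace m : lower_semicontinuous (laplace m).
Proof.
apply: lower_semicontinuous_integral => // [s|x _ s].
  exact: measurable_EFin_expRM.
apply: cvg_EFin; first exact: nearW.
by apply: cvg_comp (cvgMr_tmp cvg_id) _; exact: continuous_expR.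
Qed.

Lemma near_left_laplace_gt m l T : T%:E < laplace m l ->
  \forall s \near l^'-, T%:E < laplace m s.
Proof.
move=> /lower_semicontinuous_laplace[V lV VT].
by apply: cvg_within; exact: filterS lV.
Qed.

End laplace_transform.

Section rare_negative.
Local Open Scope ereal_scope.
Variable R : realType.
Variables (m : probability R R) (d : R).
Hypothesis d01 : (0 < d < 1)%R.
Hypothesis neg_le : forall n, (0 < n)%N ->
  iter_convolution m n neg <= (d ^+ (2 * n))%:E.

(* A first step below [-nM] followed by n steps of size less than M, each of
   probability at least d, leads below 0. *)
Lemma tail_le_of_iter_convolution_neg_le : exists2 M : R, (0 < M)%R &
  forall n, m `]-oo, (- (n%:R * M))%R]%classic <= (d ^+ n)%:E.
Proof.
have [d0 d1] := andP d01.
have [k dk] : exists k : nat, d%:E < m `]-oo, k%:R]%classic.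
  apply: contrapT => /forallNP ray_le; have cv := @cvg_measure_ray R m.
  suff : m setT <= d%:E by rewrite probability_setT lee_fin leNgt d1.
  rewrite -(cvg_lim _ cv)//; apply: lime_le; first exact: cvgP cv.
  by apply: nearW => k; rewrite leNgt; apply/negP; exact: ray_le.
exists k.+1%:R => // -[|n]; first by rewrite expr0 probability_le1.
set M : R := k.+1%:R; have dn0 : (0 < d ^+ n.+1)%R by rewrite exprn_gt0.
have steps := iter_convolution_ray_ge n.+1 (ltW d0) (ltW dk).
rewrite -(@lee_pmul2r _ (d ^+ n.+1)%:E)// ?lte_fin//.
apply: (@le_trans _ _ (iter_convolution m n.+2 neg)); last first.
  rewrite (le_trans (neg_le _))// -EFinM lee_fin -exprD addnn -mul2n.
  by rewrite ler_wiXn2l ?(ltW d0) ?(ltW d1)// leq_mul2l leqnSn.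
apply: le_trans (lee_wpmul2l _ steps) _ => //.
apply: mule_le_convolution => // x y /=; rewrite !in_itv/= => xM yk.
apply: le_lt_trans (lerD xM yk) _.
by rewrite /M -(natr1 k) mulrDr mulr1 opprD addrAC addNr add0r oppr_lt0.
Qed.

Lemma near0_laplace_neg_iter_convolution_le :
  \forall s \near 0%R^'-, forall n, (0 < n)%N ->
    laplace_on (iter_convolution m n) neg s <= (2 * d ^+ n)%:E.
Proof.
have [d0 d1] := andP d01.
have [M M0 tail] := tail_le_of_iter_convolution_neg_le.
have [l l0 l_fin] := laplace_neg_lty_of_tail d01 M0 tail.
have [L L0 LE] := laplace_lty_EFin (laplace_lty_of_neg (ltW l0) l_fin).
have [k kL] : exists k, (d ^+ k * L <= 1)%R.
  by apply: exists_exprnM_le1; rewrite gtr0_norm.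
near=> s; have ls : (l / k.+2%:R <= s)%R.
  by near: s; apply: nbhs_left_ge; rewrite pmulr_llt0// invr_gt0.
move=> n n0; pose D := (d ^+ n)%R.
have D0 : (0 < D)%R by rewrite exprn_gt0.
apply: (@le_trans _ _ (laplace_on (iter_convolution m n) neg (l / k.+2%:R))).
  apply: le_laplace_on => // x; rewrite /= in_itv/= => /ltW x0.
  by rewrite ler_wnM2r.
apply: (le_trans (laplace_on_interpolation _ _ k _ D0)) => //.
have -> : (2 * d ^+ n = D + D)%R by rewrite /D; ring.
rewrite EFinD leeD//.
  rewrite (le_trans (lee_wpmul2l _ (neg_le n0))) ?lee_fin ?invr_ge0 ?(ltW D0)//.
  by rewrite mulnC exprM expr2 mulKf// gt_eqF.
apply: (@le_trans _ _ ((D ^+ k.+1)%:E * (L ^+ n)%:E)).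
  rewrite lee_wpmul2l//; first by rewrite lee_fin exprn_ge0// ltW.
  by rewrite EFin_expe -LE -laplace_iter_convolution le_laplace_on_setT.
rewrite -EFinM lee_fin exprS -mulrA ler_piMr ?(ltW D0)//.
by rewrite /D exprAC -exprMn exprn_ile1// mulr_ge0// exprn_ge0// ltW.
Unshelve. all: by end_near. Qed.

End rare_negative.

Section determination.
Local Open Scope ereal_scope.
Variable R : realType.
Implicit Types (m : probability R R) (l s q C : R).

Definition same_measure m1 m2 : Prop := forall A, measurable A -> m1 A = m2 A.

Lemma same_measure_laplace m1 m2 :
  same_measure m1 m2 -> laplace m1 = laplace m2.
Proof.
by move=> E; apply/funext => l; apply: eq_measure_integral => A mA _; exact: E.
Qed.

Lemma same_measure_cond_a m1 m2 : same_measure m1 m2 -> cond_a m1 -> cond_a m2.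
Proof. by rewrite /cond_a => /same_measure_laplace ->. Qed.

Lemma same_measure_cond_b m1 m2 : same_measure m1 m2 -> cond_b m1 -> cond_b m2.
Proof. by rewrite /cond_b => /same_measure_laplace ->. Qed.

Lemma same_measure_of_near_left_laplace m1 m2 l :
  (forall A : set R, measurable A -> A `<=` pos -> m1 A = m2 A) ->
  (\forall s \near l^'-, laplace m1 s = laplace m2 s /\ laplace m1 s < +oo) ->
  same_measure m1 m2.
Proof.
move=> eq_pos eq_near; have [e e0 eqL] : exists2 e : R, (0 < e)%R &
    forall s, (l - e < s < l)%R ->
    laplace m1 s = laplace m2 s /\ laplace m1 s < +oo.
  have [e /= e0 eqe] := eq_near; exists e => // s /andP[es sl].
  by apply: eqe => //=; rewrite gtr0_norm ?subr_gt0//; lra.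
suff eq_ray a : m1 `]-oo, a[%classic = m2 `]-oo, a[%classic.
  exact: eq_measure_of_eq_ray eq_ray.
have [a0|a0] := ltP a 0%R; last first.
  rewrite -setCitvr !probability_setC// eq_pos// => x /=.
  by rewrite !in_itv/= !andbT; exact: le_trans.
apply: (@eq_ray_of_eq_laplace_neg _ _ _ (l - e / 2) (e / 4)) => // [|s sl].
  by rewrite divr_gt0.
have [|E fin] := eqL s; first by move: e0; lra.
have eq_laplace_pos : laplace_on m1 pos s = laplace_on m2 pos s.
  exact: eq_measure_integral.
split; last by rewrite (le_lt_trans _ fin)// le_laplace_on_setT.
have pos_fin : laplace_on m2 pos s \is a fin_num.
  rewrite ge0_fin_numE ?laplace_on_ge0// -eq_laplace_pos.
  by rewrite (le_lt_trans _ fin)// le_laplace_on_setT.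
move: E; rewrite !laplace_neg_pos eq_laplace_pos.
by move=> /(congr1 (fun z => z - laplace_on m2 pos s)); rewrite !addeK.
Qed.

Section same_pos_convpows.
Variables m1 m2 : probability R R.
Hypothesis same12 : same_pos_convpows m1 m2.

Lemma same_pos_convpows_sym : same_pos_convpows m2 m1.
Proof. by move=> n n0 A mA Apos; rewrite same12. Qed.

Lemma eq_iter_convolution_pos n (A : set R) :
  (0 < n)%N -> measurable A -> A `<=` pos ->
  iter_convolution m1 n A = iter_convolution m2 n A.
Proof. by move=> n0 mA Apos; rewrite -!convpowE same12. Qed.

Lemma eq_measure_pos (A : set R) : measurable A -> A `<=` pos -> m1 A = m2 A.
Proof.
move=> mA Apos; rewrite -(iter_convolution1 m1 mA) -(iter_convolution1 m2 mA).
exact: eq_iter_convolution_pos.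
Qed.

Lemma eq_iter_convolution_neg n : (0 < n)%N ->
  iter_convolution m1 n neg = iter_convolution m2 n neg.
Proof.
by move=> n0; rewrite -setCitvr !probability_setC// eq_iter_convolution_pos.
Qed.

Lemma le_laplace_of_neg_le s q C :
  (0 <= q)%R -> (0 <= C)%R -> q%:E < laplace m1 s ->
  (forall n, (0 < n)%N ->
    laplace_on (iter_convolution m1 n) neg s <= (C * q ^+ n)%:E) ->
  laplace m1 s <= laplace m2 s.
Proof.
move=> q0 C0 qs neg_le; apply: (lee_of_expe_leD q0 qs _ C0) => [|n n0].
  exact: laplace_on_ge0.
rewrite -!laplace_iter_convolution !laplace_neg_pos addeC leeD ?neg_le//.
rewrite [leLHS](_ : _ = laplace_on (iter_convolution m2 n) pos s).
  by rewrite leeDr// laplace_on_ge0.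
by apply: eq_measure_integral => A mA Apos; exact: eq_iter_convolution_pos.
Qed.

End same_pos_convpows.

Lemma eq_laplace_of_neg_le m1 m2 s q C : same_pos_convpows m1 m2 ->
  (0 <= q)%R -> (0 <= C)%R -> q%:E < laplace m1 s ->
  (forall n, (0 < n)%N ->
    laplace_on (iter_convolution m1 n) neg s <= (C * q ^+ n)%:E) ->
  (forall n, (0 < n)%N ->
    laplace_on (iter_convolution m2 n) neg s <= (C * q ^+ n)%:E) ->
  laplace m1 s = laplace m2 s.
Proof.
move=> same12 q0 C0 qs neg1 neg2.
have le12 := le_laplace_of_neg_le same12 q0 C0 qs neg1; apply/le_anti.
have same21 := same_pos_convpows_sym same12.
by rewrite le12 (le_laplace_of_neg_le same21 q0 C0 _ neg2)// (lt_le_trans qs).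
Qed.

Lemma same_measure_of_cond_b m1 m2 :
  same_pos_convpows m1 m2 -> cond_b m1 -> same_measure m1 m2.
Proof.
move=> same12 [l [l0 [l1 lfin]]].
apply: (same_measure_of_near_left_laplace (l := l)).
  exact: eq_measure_pos.
near=> s.
have s0 : (0 <= s)%R by near: s; exact: nbhs_left_ge.
have sl : (s <= l)%R by near: s; exact: nbhs_left_le.
have s1 : 1 < laplace m1 s by near: s; exact: near_left_laplace_gt.
have neg_le m n : (0 < n)%N ->
    laplace_on (iter_convolution m n) neg s <= (1 * 1 ^+ n)%:E.
  by move=> _; rewrite expr1n mulr1 laplace_neg_le1.
split.
  exact: (eq_laplace_of_neg_le same12 ler01 ler01 s1 (neg_le m1) (neg_le m2)).
by apply: laplace_lty_le lfin; rewrite s0.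
Unshelve. all: by end_near. Qed.

Lemma cond_a_neg_le m : cond_a m -> exists2 d : R, (0 < d < 1)%R &
  forall n, iter_convolution m n neg <= (d ^+ (2 * n))%:E.
Proof.
move=> [l [l0 l1]].
have [c c0 cE] := laplace_lty_EFin (lt_trans l1 (ltry _)).
have c1 : (c < 1)%R by rewrite -lte_fin -cE.
exists (Num.sqrt ((1 + c) / 2)).
  apply/andP; split; first by rewrite sqrtr_gt0; lra.
  by rewrite -[ltRHS]sqrtr1 ltr_sqrt//; lra.
move=> n; rewrite exprM sqr_sqrtr; last by lra.
rewrite -[leLHS]laplace_on0//.
apply: (@le_trans _ _ (laplace_on (iter_convolution m n) neg l)).
  apply: le_laplace_on => // x; rewrite /= in_itv/= mul0r => /ltW.
  exact: mulr_le0 (ltW l0).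
apply: le_trans (le_laplace_on_setT _ _ _) _ => //.
rewrite [leLHS](laplace_iter_convolution m n l) cE -EFin_expe lee_fin.
by rewrite lerXn2r ?nnegrE//; lra.
Qed.

Lemma same_measure_of_cond_a m1 m2 :
  same_pos_convpows m1 m2 -> cond_a m1 -> same_measure m1 m2.
Proof.
move=> same12 /cond_a_neg_le[d /andP[d0 d1] neg_le].
have d01 : (0 < d < 1)%R by rewrite d0.
have laplace0 : d%:E < laplace m1 0.
  by rewrite [ltRHS]laplace_on0// [ltRHS]probability_setT lte_fin.
apply: (same_measure_of_near_left_laplace (l := 0%R)).
  exact: eq_measure_pos.
near=> s.
have s0 : (s <= 0)%R by near: s; exact: nbhs_left_le.
have s1 : d%:E < laplace m1 s by near: s; exact: near_left_laplace_gt.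
have neg1 n : (0 < n)%N ->
    laplace_on (iter_convolution m1 n) neg s <= (2 * d ^+ n)%:E.
  by move: n; near: s; exact: near0_laplace_neg_iter_convolution_le.
have neg2 n : (0 < n)%N ->
    laplace_on (iter_convolution m2 n) neg s <= (2 * d ^+ n)%:E.
  move: n; near: s; apply: near0_laplace_neg_iter_convolution_le => // n n0.
  by rewrite -(eq_iter_convolution_neg same12 n0).
split; first exact: (eq_laplace_of_neg_le same12 (ltW d0) _ s1 neg1 neg2).
have -> : laplace m1 s = laplace (iter_convolution m1 1) s.
  by rewrite laplace_iter_convolution.
by rewrite laplace_lty_of_neg// (le_lt_trans (neg1 1%N _))// ltry.
Unshelve. all: by end_near. Qed.

End determination.

Theorem theorem2p7 (R : realType) (mu : probability R R) :
  ~ (msupport mu `<=` `]-oo, 0%R[) ->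
  (forall mu1 : probability R R, same_pos_convpows mu1 mu ->
     (cond_a mu1 <-> cond_a mu) /\ (cond_b mu1 <-> cond_b mu)) /\
  (cond_a mu \/ cond_b mu ->
     forall mu1 : probability R R, same_pos_convpows mu1 mu ->
       forall A : set R, measurable A -> mu1 A = mu A).
Proof.
move=> _; split=> [mu1 same1|cond mu1 same1 A mA].
  have same := same_pos_convpows_sym same1.
  split; split=> cond.
  - exact: same_measure_cond_a (same_measure_of_cond_a same1 cond) cond.
  - exact: same_measure_cond_a (same_measure_of_cond_a same cond) cond.
  - exact: same_measure_cond_b (same_measure_of_cond_b same1 cond) cond.
  - exact: same_measure_cond_b (same_measure_of_cond_b same cond) cond.
have same := same_pos_convpows_sym same1; apply/esym.
case: cond => [cond|cond]; first exact: (same_measure_of_cond_a same cond).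
exact: (same_measure_of_cond_b same cond).
Qed.
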